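(* Let $f\colon\mathbb{H}_1\to\mathbb{H}_2$ be a relatively algebraically closed homomorphism of hyperfields. If $U_1\subseteq\mathbb{H}_1^\times$ and $U_2\subseteq\mathbb{H}_2^\times$ are multiplicative subgroups such that $f(U_1)=U_2$, then the map $$\hat f\colon\mathbb{H}_1/U_1\to\mathbb{H}_2/U_2,\qquad \overline{a}\mapsto\overline{f(a)}$$ is relatively algebraically closed.
   Context: **Hyperfields.** A hyperoperation on a set $H$ is a map $\boxplus$ from $H\times H$ to the non-empty subsets of $H$; for subsets, $A\boxplus B=\bigcup_{a\in A,b\in B}a\boxplus b$, singletons are identified with their elements, and longer hypersums are obtained by iteration. A hyperfield is a tuple $(\mathbb{H},\boxplus,\odot,0_{\mathbb H},1_{\mathbb H})$ such that: $\boxplus$ is an associative and commutative hyperoperation; $0_{\mathbb H}\boxplus a=a$; each $a$ has a unique $-a$ with $0_{\mathbb H}\in a\boxplus(-a)$; $a\in b\boxplus c$ iff $c\in a\boxplus(-b)$; $\mathbb{H}^\times:=\mathbb{H}\setminus\{0_{\mathbb H}\}$ is an abelian group under the single-valued operation $\odot$ with identity $1_{\mathbb H}$; $a\odot(b\boxplus c)=(a\odot b)\boxplus(a\odot c)$; and $0_{\mathbb H}\odot a=0_{\mathbb H}$. **Quotients.** For a hyperfield $\mathbb{H}$ and a subgroup $U\subseteq\mathbb{H}^\times$, $\mathbb{H}/U$ is the hyperfield of cosets $\overline a=a\odot U=\{a\odot u\mid u\in U\}$, $a\in\mathbb{H}$, with $\overline a\odot\overline b=\overline{a\odot b}$ and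 $\overline a\boxplus\overline b=\{\overline c\mid c\in(a\odot U)\boxplus(b\odot U)\}$. **Homomorphisms.** A hyperfield homomorphism $f\colon\mathbb{H}_1\to\mathbb{H}_2$ is a map with $f(a\boxplus_1 b)\subseteq f(a)\boxplus_2 f(b)$, $f(a\odot_1 b)=f(a)\odot_2 f(b)$, $f(0)=0$, $f(1)=1$. **Univariate polynomials.** $\mathbb{H}[X]$ is the set of formal expressions $p=\boxplus_{d\in D}c_d\odot X^d$ with $D\subset\mathbb{Z}_{\ge0}$ finite and $c_d\in\mathbb{H}^\times$; $p(a)=\boxplus_{d\in D}c_d\odot a^d\subseteq\mathbb{H}$; $V(p)=\{a\in\mathbb{H}\mid 0_{\mathbb H}\in p(a)\}$. The push-forward along $f$ is $f_*(p)=\boxplus_{d\in D}f(c_d)\odot X^d$. **RAC.** A surjective hyperfield homomorphism $f\colon\mathbb{H}_1\to\mathbb{H}_2$ is relatively algebraically closed if for every $p\in\mathbb{H}_1[X]$ and every $\beta\in V(f_*(p))$ there exists $\alpha\in f^{-1}(\beta)$ with $\alpha\in V(p)$. *)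

(* Defs.v *)
From HB Require Import structures.
From mathcomp Require Import all_boot finmap.
From mathcomp Require Import boolp classical_sets.

Set Implicit Arguments.
Unset Strict Implicit.
Unset Printing Implicit Defensive.

Local Open Scope classical_set_scope.

Definition hyper_ext (T : Type) (op : T -> T -> set T) (A B : set T) : set T :=
  \bigcup_(a in A) \bigcup_(b in B) op a b.

(* The group axioms only concern nonzero elements, as in the usual definition;*)
(* they are extended to all of H in [hmulrA], [hmulrC], [hmul1r] below.       *)
HB.mixin Record isHyperfield (H : Type) := {
  hzero : H;
  hone : H;
  hadd : H -> H -> set H;
  hopp : H -> H;
  hmul : H -> H -> H;
  hadd_neq0 : forall a b, hadd a b !=set0;
  haddA : forall a b c,
    hyper_ext hadd [set a] (hadd b c) = hyper_ext hadd (hadd a b) [set c];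
  haddC : forall a b, hadd a b = hadd b a;
  hadd0 : forall a, hadd hzero a = [set a];
  hadd_opp : forall a b, hadd a b hzero <-> b = hopp a;
  hadd_rev : forall a b c, hadd b c a <-> hadd a (hopp b) c;
  hone_neq0 : hone <> hzero;
  hmul_neq0 : forall a b, a <> hzero -> b <> hzero -> hmul a b <> hzero;
  hmulA : forall a b c, a <> hzero -> b <> hzero -> c <> hzero ->
    hmul a (hmul b c) = hmul (hmul a b) c;
  hmulC : forall a b, a <> hzero -> b <> hzero -> hmul a b = hmul b a;
  hmul1 : forall a, a <> hzero -> hmul hone a = a;
  hmulV : forall a, a <> hzero -> exists2 b, b <> hzero & hmul a b = hone;
  hmulD : forall a b c,
    [set hmul a x | x in hadd b c] = hadd (hmul a b) (hmul a c);
  hmul0 : forall a, hmul hzero a = hzero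
}.

#[short(type="hyperfieldType")]
HB.structure Definition Hyperfield := {H of isHyperfield H}.

Arguments hzero {_}.
Arguments hone {_}.
Arguments hmulV {_} [a].

Section HyperfieldTheory.
Variable H : hyperfieldType.
Implicit Types a b c : H.

Lemma hmulr0 a : hmul a hzero = hzero :> H.
Proof.
have [->|a0] := pselect (a = hzero); first by rewrite hmul0.
set c := hmul a hzero; have [//|c0] := pselect (c = hzero).
have absorb x : hadd (hmul a x) c = [set hmul a x].
  by rewrite -hmulD haddC hadd0 image_set1.
have n0 : hopp c <> hzero.
  move=> nc; have : hadd c hzero hzero by apply/hadd_opp.
  by rewrite haddC hadd0 /= => /esym.
have [b b0 ab] := hmulV a0.
have := absorb (hmul b (hopp c)); rewrite hmulA // ab hmul1 // => e.
have : hadd (hopp c) c hzero by rewrite haddC; apply/hadd_opp.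
by rewrite e /= => /esym.
Qed.

Lemma hmulrC a b : hmul a b = hmul b a.
Proof.
have [->|a0] := pselect (a = hzero); first by rewrite hmul0 hmulr0.
have [->|b0] := pselect (b = hzero); first by rewrite hmul0 hmulr0.
exact: hmulC.
Qed.

Lemma hmulrA a b c : hmul a (hmul b c) = hmul (hmul a b) c.
Proof.
have [->|a0] := pselect (a = hzero); first by rewrite !hmul0.
have [->|b0] := pselect (b = hzero); first by rewrite hmul0 !hmulr0 hmul0.
have [->|c0] := pselect (c = hzero); first by rewrite !hmulr0.
exact: hmulA.
Qed.

Lemma hmul1r a : hmul hone a = a.
Proof.
by have [->|a0] := pselect (a = hzero); [rewrite hmulr0 | apply: hmul1].
Qed.

Lemma hmulr1 a : hmul a hone = a.
Proof. by rewrite hmulrC hmul1r. Qed.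

Lemma hadd_mulr a b c d : hadd a b c -> hadd (hmul a d) (hmul b d) (hmul c d).
Proof. by rewrite ![hmul _ d]hmulrC -hmulD => abc; exists c. Qed.

Lemma hoppM a d : hopp (hmul a d) = hmul (hopp a) d.
Proof.
apply/esym/hadd_opp; rewrite -(hmul0 d).
by apply: hadd_mulr; apply/hadd_opp.
Qed.

Lemma haddrA a b c x y : hadd a b x -> hadd x c y ->
  exists2 z, hadd b c z & hadd a z y.
Proof.
move=> abx xcy.
have : hyper_ext hadd (hadd a b) [set c] y by exists x => //; exists c.
by rewrite -haddA => -[_ ->] [z bcz azy]; exists z.
Qed.

Definition hadds : set H -> set H -> set H := hyper_ext hadd.

Lemma haddsP (A B : set H) x :
  hadds A B x <-> exists a b, [/\ A a, B b & hadd a b x].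
Proof.
split=> [[a Aa [b Bb abx]]|[a [b [Aa Bb abx]]]]; first by exists a, b.
by exists a => //; exists b.
Qed.

Lemma haddsC : commutative hadds.
Proof.
by move=> A B; apply/seteqP; split=> x /haddsP[a [b [Aa Bb abx]]];
  apply/haddsP; exists b, a; rewrite haddC.
Qed.

Lemma haddsA : associative hadds.
Proof.
have sub A B C : hadds (hadds A B) C `<=` hadds A (hadds B C).
  move=> x /haddsP[y [c [/haddsP[a [b [Aa Bb aby]]] Cc ycx]]].
  have [z bcz azx] := haddrA aby ycx.
  by apply/haddsP; exists a, z; split=> //; apply/haddsP; exists b, c.
move=> A B C; apply/seteqP; split=> //.
by rewrite (haddsC A) (haddsC (hadds A B)) (haddsC B) (haddsC A).
Qed.

Lemma hadd0s : left_id [set hzero] hadds.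
Proof.
move=> A; apply/seteqP; split=> x.
  by move=> /haddsP[_ [b [-> Ab]]]; rewrite hadd0 /= => ->.
by move=> Ax; apply/haddsP; exists hzero, x; rewrite hadd0.
Qed.

HB.instance Definition _ :=
  Monoid.isComLaw.Build (set H) [set hzero] hadds haddsA haddsC hadd0s.

Definition hexp a (n : nat) : H := iter n (hmul a) hone.

End HyperfieldTheory.

Record mulSubgroup (H : hyperfieldType) := MulSubgroup {
  subgroup_set :> set H;
  subgroup_neq0 : forall u, subgroup_set u -> u <> hzero;
  subgroup1 : subgroup_set hone;
  subgroupM : forall u v, subgroup_set u -> subgroup_set v ->
    subgroup_set (hmul u v);
  subgroupV : forall u v, subgroup_set u -> hmul u v = hone -> subgroup_set v
}.

Section Quotient.
Variables (H : hyperfieldType) (U : mulSubgroup H).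
Implicit Types a b c : H.

Definition coset_set a : set H := [set hmul a u | u in U].

Definition hquot : Type := {A : set H | exists a, A = coset_set a}.

Definition hcoset a : hquot := exist _ (coset_set a) (ex_intro _ a erefl).

Definition hrepr (A : hquot) : H := sval (cid (proj2_sig A)).

Lemma hreprK A : hcoset (hrepr A) = A.
Proof. by case: A => A hA; apply: eq_exist; rewrite -(svalP (cid hA)). Qed.

Lemma hcosetP a b :
  hcoset a = hcoset b <-> exists2 u, subgroup_set U u & b = hmul a u.
Proof.
split=> [[/seteqP[_ ab]]|[u Uu ->]].
  have [|u Uu <-] := ab b; last by exists u.
  by exists hone; [exact: subgroup1 | rewrite hmulr1].
apply: eq_exist; apply/seteqP; split=> _ [v Uv <-].
  have [w _ uw] := hmulV (subgroup_neq0 Uu).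
  exists (hmul w v); first exact: subgroupM (subgroupV Uu uw) Uv.
  by rewrite -hmulrA (hmulrA u) uw hmul1r.
by exists (hmul u v); [exact: subgroupM | rewrite hmulrA].
Qed.

Definition hquot_add (A B : hquot) : set hquot :=
  [set hcoset c | c in hadds (sval A) (sval B)].

(* Defined through chosen representatives; [hcoset_mul] and [hcoset_opp] show *)
(* that the result does not depend on them.                                  *)
Definition hquot_mul (A B : hquot) : hquot := hcoset (hmul (hrepr A) (hrepr B)).
Definition hquot_opp (A : hquot) : hquot := hcoset (hopp (hrepr A)).

Lemma hcoset_mul a b : hquot_mul (hcoset a) (hcoset b) = hcoset (hmul a b).
Proof.
have /hcosetP[u Uu eu] := hreprK (hcoset a).
have /hcosetP[v Uv ev] := hreprK (hcoset b).
apply/hcosetP; exists (hmul u v); first exact: subgroupM.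
rewrite {1}eu {1}ev -!hmulrA; congr hmul.
by rewrite hmulrA (hmulrC u) -hmulrA.
Qed.

Lemma hcoset_opp a : hquot_opp (hcoset a) = hcoset (hopp a).
Proof.
have /hcosetP[u Uu eu] := hreprK (hcoset a).
by apply/hcosetP; exists u => //; rewrite {1}eu hoppM.
Qed.

Lemma hcoset_add a b c : hquot_add (hcoset a) (hcoset b) (hcoset c) <->
  exists u v,
    [/\ subgroup_set U u, subgroup_set U v & hadd (hmul a u) (hmul b v) c].
Proof.
split=> [[x /haddsP[_ [_ [[u Uu <-] [v Uv <-] h]]] /hcosetP[w Uw ->]]|].
  exists (hmul u w), (hmul v w); rewrite !hmulrA.
  by split; [exact: subgroupM | exact: subgroupM | exact: hadd_mulr].
move=> [u [v [Uu Uv h]]]; exists c => //; apply/haddsP.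
by exists (hmul a u), (hmul b v); split=> //; [exists u | exists v].
Qed.

Lemma hcoset_ind (P : hquot -> Prop) : (forall a, P (hcoset a)) -> forall A, P A.
Proof. by move=> h A; rewrite -(hreprK A). Qed.

Lemma hcoset_eq0 a : hcoset a = hcoset hzero <-> a = hzero.
Proof.
by split=> [/esym/hcosetP[u _ ->]|->//]; rewrite hmul0.
Qed.

Lemma hcoset_neq0 a : hcoset a <> hcoset hzero -> a <> hzero.
Proof. by move=> h e; apply: h; rewrite e. Qed.

Lemma hquot_add_neq0 A B : hquot_add A B !=set0.
Proof.
elim/hcoset_ind: A => a; elim/hcoset_ind: B => b.
have [c h] := hadd_neq0 a b.
exists (hcoset c); apply/hcoset_add; exists hone, hone; rewrite !hmulr1.
by split=> //; exact: subgroup1.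
Qed.

Lemma hquot_addC A B : hquot_add A B = hquot_add B A.
Proof. by rewrite /hquot_add haddsC. Qed.

Lemma hquot_addA_sub A B C :
  hyper_ext hquot_add (hquot_add A B) [set C] `<=`
  hyper_ext hquot_add [set A] (hquot_add B C).
Proof.
elim/hcoset_ind: A => a; elim/hcoset_ind: B => b; elim/hcoset_ind: C => c.
move=> D [E abE [_ -> EcD]].
elim/hcoset_ind: E abE EcD => e /hcoset_add[u [v [Uu Uv abe]]].
elim/hcoset_ind: D => d /hcoset_add[w [z [Uw Uz ecd]]].
have [g bcg agd] := haddrA (hadd_mulr w abe) ecd.
exists (hcoset a) => //; exists (hcoset g).
  apply/hcoset_add; exists (hmul v w), z; rewrite hmulrA.
  by split=> //; exact: subgroupM.
apply/hcoset_add; exists (hmul u w), hone; rewrite hmulr1 hmulrA.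
by split=> //; [exact: subgroupM | exact: subgroup1].
Qed.

Lemma hquot_addA A B C :
  hyper_ext hquot_add [set A] (hquot_add B C) =
  hyper_ext hquot_add (hquot_add A B) [set C].
Proof.
have flip (X Y : set hquot) :
    hyper_ext hquot_add X Y `<=` hyper_ext hquot_add Y X.
  by move=> x [a Xa [b Yb h]]; exists b => //; exists a; rewrite // hquot_addC.
apply/seteqP; split; last exact: hquot_addA_sub.
move=> x /flip; rewrite hquot_addC => /hquot_addA_sub /flip.
by rewrite (hquot_addC B).
Qed.

Lemma hquot_add0 A : hquot_add (hcoset hzero) A = [set A].
Proof.
elim/hcoset_ind: A => a; apply/seteqP; split=> [C|_ ->].
  elim/hcoset_ind: C => c /hcoset_add[u [v [Uu Uv]]].
  by rewrite hmul0 hadd0 /= => ->; apply/esym/hcosetP; exists v.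
apply/hcoset_add; exists hone, hone; rewrite hmul0 hadd0 /= hmulr1.
by split=> //; exact: subgroup1.
Qed.

Lemma hquot_add_opp A B :
  hquot_add A B (hcoset hzero) <-> B = hquot_opp A.
Proof.
elim/hcoset_ind: A => a; elim/hcoset_ind: B => b; rewrite hcoset_opp.
split=> [/hcoset_add[u [v [Uu Uv /hadd_opp bv]]]|].
  transitivity (hcoset (hmul b v)); first by apply/hcosetP; exists v.
  by rewrite bv hoppM; apply/esym/hcosetP; exists u.
move=> /esym/hcosetP[u Uu ->]; apply/hcoset_add; exists u, hone.
by rewrite hmulr1; split=> //; [exact: subgroup1 | apply/hadd_opp; rewrite hoppM].
Qed.

Lemma hquot_add_rev A B C :
  hquot_add B C A <-> hquot_add A (hquot_opp B) C.
Proof.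
elim/hcoset_ind: A => a; elim/hcoset_ind: B => b; elim/hcoset_ind: C => c.
have inv u : subgroup_set U u -> exists2 w, subgroup_set U w & hmul u w = hone.
  move=> Uu; have [w _ uw] := hmulV (subgroup_neq0 Uu).
  by exists w => //; exact: subgroupV Uu uw.
rewrite hcoset_opp !hcoset_add; split=> -[u [v [Uu Uv]]].
  have [w Uw vw] := inv v Uv.
  move=> /(hadd_mulr w) /hadd_rev; rewrite -!hmulrA vw hmulr1 hoppM => h.
  by exists w, (hmul u w); split=> //; exact: subgroupM.
have [w Uw uw] := inv u Uu.
move=> /(hadd_mulr w); rewrite -!hmulrA uw hmulr1 -hoppM => h.
by exists (hmul v w), w; split; [exact: subgroupM | | apply/hadd_rev].
Qed.

Lemma hquot_one_neq0 : hcoset hone <> hcoset hzero.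
Proof. by move=> /hcoset_eq0; exact: hone_neq0. Qed.

Lemma hquot_mul_neq0 A B : A <> hcoset hzero -> B <> hcoset hzero ->
  hquot_mul A B <> hcoset hzero.
Proof.
elim/hcoset_ind: A => a; elim/hcoset_ind: B => b.
move=> /hcoset_neq0 a0 /hcoset_neq0 b0; rewrite hcoset_mul => /hcoset_eq0.
exact: hmul_neq0.
Qed.

Lemma hquot_mulA A B C : A <> hcoset hzero -> B <> hcoset hzero ->
  C <> hcoset hzero -> hquot_mul A (hquot_mul B C) = hquot_mul (hquot_mul A B) C.
Proof.
move=> _ _ _.
elim/hcoset_ind: A => a; elim/hcoset_ind: B => b; elim/hcoset_ind: C => c.
by rewrite !hcoset_mul hmulrA.
Qed.

Lemma hquot_mulC A B : A <> hcoset hzero -> B <> hcoset hzero ->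
  hquot_mul A B = hquot_mul B A.
Proof.
move=> _ _; elim/hcoset_ind: A => a; elim/hcoset_ind: B => b.
by rewrite !hcoset_mul hmulrC.
Qed.

Lemma hquot_mul1 A : A <> hcoset hzero -> hquot_mul (hcoset hone) A = A.
Proof. by move=> _; elim/hcoset_ind: A => a; rewrite hcoset_mul hmul1r. Qed.

Lemma hquot_mulV A : A <> hcoset hzero ->
  exists2 B, B <> hcoset hzero & hquot_mul A B = hcoset hone.
Proof.
elim/hcoset_ind: A => a /hcoset_neq0 a0; have [b b0 ab] := hmulV a0.
by exists (hcoset b); [move=> /hcoset_eq0 | rewrite hcoset_mul ab].
Qed.

Lemma hquot_mulD A B C : [set hquot_mul A X | X in hquot_add B C] =
  hquot_add (hquot_mul A B) (hquot_mul A C).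
Proof.
elim/hcoset_ind: A => a; elim/hcoset_ind: B => b; elim/hcoset_ind: C => c.
rewrite !hcoset_mul; apply/seteqP; split=> [_ [X bcX <-]|X].
  elim/hcoset_ind: X bcX => x /hcoset_add[u [v [Uu Uv h]]].
  rewrite hcoset_mul; apply/hcoset_add; exists u, v; split=> //.
  by rewrite -!hmulrA -hmulD; exists x.
elim/hcoset_ind: X => x /hcoset_add[u [v [Uu Uv]]].
rewrite -!hmulrA -hmulD => -[y h <-]; exists (hcoset y).
  by apply/hcoset_add; exists u, v.
by rewrite hcoset_mul.
Qed.

Lemma hquot_mul0 A : hquot_mul (hcoset hzero) A = hcoset hzero.
Proof. by elim/hcoset_ind: A => a; rewrite hcoset_mul hmul0. Qed.

HB.instance Definition _ := isHyperfield.Build hquot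
  hquot_add_neq0 hquot_addA hquot_addC hquot_add0 hquot_add_opp hquot_add_rev
  hquot_one_neq0 hquot_mul_neq0 hquot_mulA hquot_mulC hquot_mul1 hquot_mulV
  hquot_mulD hquot_mul0.

End Quotient.

HB.mixin Record isHyperfieldMorphism (H1 H2 : hyperfieldType) (f : H1 -> H2) := {
  hmorphD : forall a b, f @` hadd a b `<=` hadd (f a) (f b);
  hmorphM : forall a b, f (hmul a b) = hmul (f a) (f b);
  hmorph0 : f hzero = hzero;
  hmorph1 : f hone = hone
}.

HB.structure Definition HyperfieldMorphism (H1 H2 : hyperfieldType) :=
  {f of isHyperfieldMorphism H1 H2 f}.

Notation "{ 'hmorphism' H1 -> H2 }" := (HyperfieldMorphism.type H1 H2)
  (at level 0, H1 at level 98, H2 at level 99,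
   format "{ 'hmorphism'  H1  ->  H2 }") : type_scope.

Lemma hmorph_neq0 (H1 H2 : hyperfieldType) (f : {hmorphism H1 -> H2}) a :
  a <> hzero -> f a <> hzero.
Proof.
move=> /hmulV[b _ ab] fa0; apply: (@hone_neq0 H2).
by rewrite -(hmorph1 (s := f)) -ab hmorphM fa0 hmul0.
Qed.

(* Formal expressions: the domain of the finite map is the set D of exponents *)
(* and the value at d in D is the nonzero coefficient c_d.                    *)
Record hpoly (H : hyperfieldType) := HPoly {
  hcoef : {fmap nat -> H};
  hcoef_neq0 : forall d : domf hcoef, hcoef d <> hzero
}.

Definition heval (H : hyperfieldType) (p : hpoly H) (a : H) : set H :=
  \big[@hadds H/[set hzero]]_(d : domf (hcoef p))
    [set hmul (hcoef p d) (hexp a (val d))].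

Definition hroots (H : hyperfieldType) (p : hpoly H) : set H :=
  [set a | heval p a hzero].

Section PushForward.
Variables (H1 H2 : hyperfieldType) (f : {hmorphism H1 -> H2}) (p : hpoly H1).

Definition hpush_coef : {fmap nat -> H2} :=
  [fmap d : domf (hcoef p) => f (hcoef p d)]%fmap.

Lemma hpush_coef_neq0 (d : domf hpush_coef) : hpush_coef d <> hzero.
Proof. by rewrite ffunE; apply: hmorph_neq0; exact: hcoef_neq0. Qed.

Definition hpush : hpoly H2 := HPoly hpush_coef_neq0.

End PushForward.

Definition relatively_algebraically_closed (H1 H2 : hyperfieldType)
    (f : {hmorphism H1 -> H2}) : Prop :=
  (forall b, exists a, f a = b) /\
  (forall (p : hpoly H1) (b : H2), hroots (hpush f p) b ->
    exists2 a, f a = b & hroots p a).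

(* Main.v *)
Require Import Defs.
From HB Require Import structures.
From mathcomp Require Import all_boot finmap.
From mathcomp Require Import boolp classical_sets.

Set Implicit Arguments.
Unset Strict Implicit.
Unset Printing Implicit Defensive.

Local Open Scope classical_set_scope.

(** The point is that [c] lies in the hypersum of cosets of the [x_d] exactly when
    [c] lies in a hypersum of suitable representatives [x_d u_d] with [u_d] in [U].
    Hence a root [b] of the push-forward of [P] over [H2/U2] is a root of a
    polynomial over [H2] with coefficients [f(c_d) u_d], [u_d] in [U2]. As
    [U2 = f(U1)], we have [u_d = f(v_d)], so this is the push-forward of the
    polynomial with coefficients [c_d v_d], whose root above [b] projects to a root
    of [P]. *)

(** Indexing by a sequence allows induction on the summands; [heval] is the case where [r]
    enumerates the exponents. *)
Definition hsum {H : hyperfieldType} {I : Type} (r : seq I) (x : I -> H) : set H :=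
  \big[@hadds H/[set hzero]]_(i <- r) [set x i].

Section Hypersum.
Variables (H : hyperfieldType).

Lemma hsum_nil (I : Type) (x : I -> H) : hsum [::] x = [set hzero].
Proof. by rewrite /hsum big_nil. Qed.

Lemma hsum_cons (I : Type) (i : I) (r : seq I) (x : I -> H) (c : H) :
  hsum (i :: r) x c <-> exists2 s, hsum r x s & hadd (x i) s c.
Proof.
rewrite /hsum big_cons; split.
  by move=> /haddsP[_ [s [-> rs h]]]; exists s.
by move=> [s rs h]; apply/haddsP; exists (x i), s.
Qed.

Lemma hsum_mulr (I : Type) (r : seq I) (x : I -> H) (c d : H) :
  hsum r x c -> hsum r (fun i => hmul (x i) d) (hmul c d).
Proof.
elim: r c => [|i r IH] c; first by rewrite !hsum_nil => ->; exact: hmul0.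
by move=> /hsum_cons[s /IH rs /(hadd_mulr d) h]; apply/hsum_cons; exists (hmul s d).
Qed.

Lemma eq_in_hsum (I : eqType) (r : seq I) (x y : I -> H) :
  {in r, x =1 y} -> hsum r x = hsum r y.
Proof. by move=> xy; apply: eq_big_seq => i /xy ->. Qed.

Lemma eq_hsum (I : Type) (r : seq I) (x y : I -> H) (c : H) :
  x =1 y -> hsum r x c -> hsum r y c.
Proof. by move=> /funext ->. Qed.

End Hypersum.

Section QuotientSum.
Variables (H : hyperfieldType) (U : mulSubgroup H).

Lemma hcoset_mulr (a u : H) : subgroup_set U u -> hcoset U (hmul a u) = hcoset U a.
Proof. by move=> Uu; apply/esym/hcosetP; exists u. Qed.

Lemma hexp_hcoset (a : H) (n : nat) :
  hexp (hcoset U a) n = hcoset U (hexp a n).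
Proof. by elim: n => //= n ->; exact: hcoset_mul. Qed.

(** The projection to the quotient respects hypersums: at each step both factors from [U] in
    [hcoset_add] can be taken to be [hone]. *)
Lemma hsum_hcoset (I : Type) (r : seq I) (x : I -> H) (c : H) :
  hsum r x c -> hsum r (fun i => hcoset U (x i)) (hcoset U c).
Proof.
elim: r c => [|i r IH] c; first by rewrite !hsum_nil => ->.
move=> /hsum_cons[s /IH rs h]; apply/hsum_cons; exists (hcoset U s) => //.
apply/hcoset_add; exists hone, hone; rewrite !hmulr1.
by split=> //; exact: subgroup1.
Qed.

(** By induction on [r], [hcoset_add] places [c] in the hypersum of [x i] times [v] and [s] times
    [w]; distributivity then moves [w] into the representatives already found for [s]. Distinct
    indices let [u] be prescribed at [i] without disturbing the tail. *)
Lemma hsum_hcoset_lift (I : eqType) (r : seq I) (x : I -> H) (c : H) :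
    uniq r -> hsum r (fun i => hcoset U (x i)) (hcoset U c) ->
  exists2 u : I -> H, (forall i, subgroup_set U (u i)) & hsum r (fun i => hmul (x i) (u i)) c.
Proof.
elim: r c => [|i r IH] c /=.
  move=> _; rewrite hsum_nil => /hcoset_eq0 ->.
  exists (fun=> hone); first by move=> _; exact: subgroup1.
  by rewrite hsum_nil.
move=> /andP[ir /IH{}IH] /hsum_cons[S].
elim/hcoset_ind: S => s /IH[u Uu rs] /hcoset_add[v [w [Uv Uw h]]].
exists (fun j => if j == i then v else hmul (u j) w).
  by move=> j; case: ifP => // _; exact: subgroupM.
apply/hsum_cons; exists (hmul s w); last by rewrite eqxx.
(* Since [i] does not occur in [r], the special value [v] at [i] is invisible here. *)
rewrite (@eq_in_hsum _ _ _ _ (fun j => hmul (hmul (x j) (u j)) w)).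
  exact: hsum_mulr.
by move=> j jr /=; case: eqP ir => [<-|_ _]; rewrite ?jr ?hmulrA.
Qed.

End QuotientSum.

Section Polynomials.
Variable H : hyperfieldType.

Lemma heval_hsum (p : hpoly H) (a : H) :
  heval p a =
  hsum (index_enum (domf (hcoef p))) (fun d => hmul (hcoef p d) (hexp a (val d))).
Proof. by []. Qed.

Lemma heval_fmap (D : {fset nat}) (c : D -> H)
    (c0 : forall d, [fmap d : D => c d]%fmap d <> hzero) (a : H) :
  heval (HPoly c0) a = hsum (index_enum D) (fun d => hmul (c d) (hexp a (val d))).
Proof. by apply: eq_bigr => d _; rewrite /= ffunE. Qed.

Lemma heval_hpush (H' : hyperfieldType) (f : {hmorphism H -> H'}) (p : hpoly H)
    (b : H') :
  heval (hpush f p) b =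
  hsum (index_enum (domf (hcoef p))) (fun d => hmul (f (hcoef p d)) (hexp b (val d))).
Proof. by apply: eq_bigr => d _; rewrite /= ffunE. Qed.

End Polynomials.

(** The map is independent of representatives: two of them differ by a factor in [U1], and [f] sends
    that factor into [U2]. *)
Lemma hquot_morphism (H1 H2 : hyperfieldType) (f : {hmorphism H1 -> H2})
    (U1 : mulSubgroup H1) (U2 : mulSubgroup H2) : f @` U1 `<=` U2 ->
  exists fhat : {hmorphism hquot U1 -> hquot U2},
    forall a, fhat (hcoset U1 a) = hcoset U2 (f a).
Proof.
move=> fU; pose g (A : hquot U1) := hcoset U2 (f (hrepr A)).
have gE a : g (hcoset U1 a) = hcoset U2 (f a).
  have /esym/hcosetP[u Uu e] := hreprK (hcoset U1 a).
  by rewrite /g e hmorphM hcoset_mulr //; apply: fU; exists u.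
have gD A B : g @` hadd A B `<=` hadd (g A) (g B).
  elim/hcoset_ind: A => a; elim/hcoset_ind: B => b _ [C abC <-].
  elim/hcoset_ind: C abC => c /hcoset_add[u [v [Uu Uv h]]].
  rewrite !gE; apply/hcoset_add; exists (f u), (f v).
  split; [by apply: fU; exists u | by apply: fU; exists v |].
  by rewrite -!hmorphM; apply: hmorphD; exists c.
have gM A B : g (hmul A B) = hmul (g A) (g B).
  elim/hcoset_ind: A => a; elim/hcoset_ind: B => b.
  by rewrite [hmul (hcoset _ _) _]hcoset_mul !gE hmorphM [RHS]hcoset_mul.
have g0 : g hzero = hzero by rewrite gE hmorph0.
have g1 : g hone = hone by rewrite gE hmorph1.
pose gMorph := isHyperfieldMorphism.Build _ _ g gD gM g0 g1.
pose fhat : {hmorphism hquot U1 -> hquot U2} := HB.pack g gMorph.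
by exists fhat.
Qed.

Theorem proposition3p19 (H1 H2 : hyperfieldType) (f : {hmorphism H1 -> H2})
    (f_rac : relatively_algebraically_closed f)
    (U1 : mulSubgroup H1) (U2 : mulSubgroup H2) (fU : f @` U1 = U2) :
  exists fhat : {hmorphism hquot U1 -> hquot U2},
    (forall a : H1, fhat (hcoset U1 a) = hcoset U2 (f a)) /\
    relatively_algebraically_closed fhat.
Proof.
have [f_surj f_roots] := f_rac.
have [|fhat fhatE] := @hquot_morphism _ _ f U1 U2; first by rewrite fU.
exists fhat; split=> //; split=> [B|P B].
  elim/hcoset_ind: B => b; have [a <-] := f_surj b.
  by exists (hcoset U1 a).
elim/hcoset_ind: B => b; rewrite /hroots /= heval_hpush.
pose c d := hrepr (hcoef P d).
have cE d : hcoef P d = hcoset U1 (c d) by rewrite hreprK.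
have fcE d : hmul (fhat (hcoef P d)) (hexp (hcoset U2 b) (val d)) =
    hcoset U2 (hmul (f (c d)) (hexp b (val d))).
  by rewrite cE fhatE hexp_hcoset [LHS]hcoset_mul.
move=> /(eq_hsum fcE)/(hsum_hcoset_lift (index_enum_uniq _))[u U2u sum_u].
(* Here the inclusion of [U2] in the image of [U1] is used. *)
have /choice[v vP] : forall d, exists v, subgroup_set U1 v /\ f v = u d.
  by move=> d; have := U2u d; rewrite -fU => -[v Uv <-]; exists v.
(* The factor [c d] is nonzero because its coset is a coefficient of [P], so twisting by [v] keeps
   the set of exponents. *)
have cv_neq0 d : [fmap d : domf (hcoef P) => hmul (c d) (v d)]%fmap d <> hzero.
  rewrite ffunE; apply: hmul_neq0; last exact: subgroup_neq0 (vP d).1.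
  by move=> c0; apply: (hcoef_neq0 (h := P) (d := d)); rewrite cE c0.
have [|a fab] := f_roots (HPoly cv_neq0) b.
  rewrite /hroots /= heval_hpush; apply: eq_hsum sum_u => d.
  rewrite /= ffunE hmorphM (vP d).2.
  by rewrite -!hmulrA (hmulrC (u d)).
(* Under the projection each [v d] is absorbed into the coset of [c d], which leaves the terms of
   [P] at the coset of [a]. *)
rewrite /hroots /= heval_fmap => /(hsum_hcoset U1) sum_a.
exists (hcoset U1 a); first by rewrite fhatE fab.
rewrite heval_hsum; apply: eq_hsum sum_a => d; rewrite cE hexp_hcoset [RHS]hcoset_mul.
by rewrite -hmulrA (hmulrC (v d)) hmulrA hcoset_mulr //; exact: (vP d).1.
Qed.
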